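(* Let $m,n$ be positive integers with at least one of $m,n$ greater than $1$. The pseudograph $\mathcal{K}_{m,n}$ admits a Möbius knight's tour if and only if at least one of $m$ and $n$ is odd.
   Context: Let $\mathcal{P}$ be the graph with vertex set $\mathbb{Z}^2$ in which $(a,b)$ and $(a',b')$ are adjacent iff $\{|a-a'|,|b-b'|\}=\{1,2\}$. For positive integers $m,n$ let $G$ be the group of automorphisms of $\mathcal{P}$ generated by $\tau(a,b)=(a+m,b)$ and $\sigma(a,b)=(m-1-a,\,b+n)$; it acts freely, and the knight's pseudograph of the $m\times n$ Klein bottle board is $\mathcal{K}_{m,n}=\mathcal{P}/G$ (vertices and edges are orbits; multiple edges and loops may occur), with covering map $\phi_K:\mathcal{P}\to\mathcal{K}_{m,n}$. A knight's tour is a closed walk visiting every vertex exactly once apart from the repeated start/end vertex (a Hamiltonian cycle). Regard a tour as a closed walk starting and ending at vertex $(0,0)$; it lifts uniquely to a walk in $\mathcal{P}$ starting at $(0,0)$. The tour is a Möbius tour if this lift ends at $(m-1,n)$ or $(m-1,-n)$ (equivalently, its homotopy class is the image of a generator of the fundamental group of the Möbius strip obtained by identifying only the top and bottom sides of the board with a half-twist). *)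

(* Defs.v *)
From Stdlib Require Import ZArith Relations.
Open Scope Z_scope.

Definition pt : Type := (Z * Z)%type.

Definition knight_adj (p q : pt) : Prop :=
  let da := Z.abs (fst p - fst q) in
  let db := Z.abs (snd p - snd q) in
  (da = 1 /\ db = 2) \/ (da = 2 /\ db = 1).

Definition tau (m : Z) (p : pt) : pt := (fst p + m, snd p).
Definition sigma (m n : Z) (p : pt) : pt := (m - 1 - fst p, snd p + n).

Definition gen_step (m n : Z) (p q : pt) : Prop := q = tau m p \/ q = sigma m n p.

(* p and q lie in the same G-orbit, i.e. phi_K p = phi_K q, where G is the
   group generated by tau and sigma: the equivalence closure of the
   generator steps. *)
Definition same_vertex (m n : Z) : pt -> pt -> Prop :=
  clos_refl_sym_trans pt (gen_step m n).

(* A knight's tour of K_{m,n} regarded as a closed walk starting and ending at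
   the vertex phi_K (0,0), given through its (unique) lift w 0, ..., w N to P
   starting at (0,0): consecutive lifted points are adjacent in P, the walk
   closes up in K_{m,n}, the vertices phi_K (w 0), ..., phi_K (w (N-1)) are
   pairwise distinct and every vertex of K_{m,n} is among them. *)
Definition lifted_tour (m n : Z) (w : nat -> pt) (N : nat) : Prop :=
  (0 < N)%nat /\
  w 0%nat = (0, 0) /\
  (forall i : nat, (i < N)%nat -> knight_adj (w i) (w (S i))) /\
  same_vertex m n (w N) (w 0%nat) /\
  (forall i j : nat, (i < N)%nat -> (j < N)%nat ->
      same_vertex m n (w i) (w j) -> i = j) /\
  (forall p : pt, exists i : nat, (i < N)%nat /\ same_vertex m n p (w i)).

Definition mobius_tour (m n : Z) (w : nat -> pt) (N : nat) : Prop :=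
  lifted_tour m n w N /\ (w N = (m - 1, n) \/ w N = (m - 1, - n)).

(* Main.v *)
(* A tour has mn steps, each of which changes the parity of a + b; if m and n are both
   even, the lift therefore cannot end at (m-1,n) or (m-1,-n).

   Conversely, for n >= 3 the lift is stacked from knight's paths through all cells of
   cylinders with few rows: the path of a 4-row cylinder that leaves it right above its
   starting point is repeated, and is followed by a cylinder of 3, 4, 5 or 6 rows that shifts
   the first coordinate by m - 1.  The path of a cylinder contains periodic strands running
   along it, and lengthening the strands enlarges m, so for each number of rows and residue
   class of m a finite computation suffices.  For n = 1, 2 there is an explicit formula.
   A walk with mn steps that meets all vertices meets each of them once. *)
Require Import Defs.
From Stdlib Require Import ZArith Relations Lia List Bool FinFun.
Import ListNotations.
Open Scope Z_scope.

Lemma NoDup_list_prod {A B : Type} (l : list A) (l' : list B) :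
  NoDup l -> NoDup l' -> NoDup (list_prod l l').
Proof.
  intros Hl Hl'. induction Hl as [|a l Ha Hl IH]; cbn; [constructor|].
  apply NoDup_app; auto.
  - apply Injective_map_NoDup; auto. intros x y [= ->]. reflexivity.
  - intros [x y] (z & [= -> ->] & _)%in_map_iff (Hx & _)%in_prod_iff. auto.
Qed.

(** * Orbits of the group, the fundamental board and counting on it *)

Section Quotient.
Variables m n : Z.
Hypotheses (Hm : 0 < m) (Hn : 0 < n).

(** The representative of an orbit on the board. Lowering by [n] costs one reflection, an
    involution, so only the parity of [snd p / n] matters. *)
Definition repr (p : pt) : pt :=
  ((if Z.even (snd p / n) then fst p else m - 1 - fst p) mod m, snd p mod n).

Lemma same_vertex_shift (j a b : Z) : same_vertex m n (a + j * m, b) (a, b).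
Proof.
  assert (Hpos : forall k : nat, forall c, same_vertex m n (c + Z.of_nat k * m, b) (c, b)).
  { induction k as [|k IH]; intros c.
    - replace (c + Z.of_nat 0 * m) with c by lia. apply rst_refl.
    - apply rst_trans with (c + Z.of_nat k * m, b); [|apply IH].
      apply rst_sym, rst_step. left. unfold tau; cbn [fst snd]. f_equal. lia. }
  destruct (Z_le_gt_dec 0 j) as [H|H].
  - rewrite <- (Z2Nat.id j) by lia. apply Hpos.
  - apply rst_sym. specialize (Hpos (Z.to_nat (- j)) (a + j * m)).
    rewrite Z2Nat.id in Hpos by lia.
    replace (a + j * m + - j * m) with a in Hpos by lia. exact Hpos.
Qed.

Lemma same_vertex_sigma (a b : Z) : same_vertex m n (a, b) (m - 1 - a, b + n).
Proof. apply rst_step. right. reflexivity. Qed.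

Lemma same_vertex_repr (p : pt) : same_vertex m n p (repr p).
Proof.
  assert (Hrow : forall k : nat, forall a b,
    same_vertex m n (a, b + Z.of_nat k * n)
      ((if Z.even (Z.of_nat k) then a else m - 1 - a), b)).
  { induction k as [|k IH]; intros a b.
    - replace (b + Z.of_nat 0 * n) with b by lia. apply rst_refl.
    - apply rst_trans with (m - 1 - a, b + Z.of_nat k * n).
      + replace a with (m - 1 - (m - 1 - a)) at 1 by lia.
        replace (b + Z.of_nat (S k) * n) with (b + Z.of_nat k * n + n) by lia.
        apply rst_sym, same_vertex_sigma.
      + specialize (IH (m - 1 - a) b).
        rewrite Nat2Z.inj_succ, Z.even_succ, <- Z.negb_even.
        destruct (Z.even (Z.of_nat k)); cbn [negb] in *; auto.
        replace a with (m - 1 - (m - 1 - a)) at 2 by lia. exact IH. }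
  assert (Hrow' : forall q a b,
    same_vertex m n (a, b + q * n) ((if Z.even q then a else m - 1 - a), b)).
  { intros q a b. destruct (Z_le_gt_dec 0 q) as [H|H].
    - rewrite <- (Z2Nat.id q) by lia. apply Hrow.
    - apply rst_sym.
      specialize (Hrow (Z.to_nat (- q)) (if Z.even q then a else m - 1 - a) (b + q * n)).
      rewrite Z2Nat.id, Z.even_opp in Hrow by lia.
      replace (b + q * n + - q * n) with b in Hrow by lia.
      destruct (Z.even q); auto.
      replace a with (m - 1 - (m - 1 - a)) at 2 by lia. exact Hrow. }
  destruct p as [a b]. unfold repr; cbn [fst snd].
  apply rst_trans with ((if Z.even (b / n) then a else m - 1 - a), b mod n).
  - specialize (Hrow' (b / n) a (b mod n)).
    replace (b mod n + b / n * n) with b in Hrow'; auto.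
    rewrite (Z.div_mod b n) at 1 by lia. lia.
  - set (x := if Z.even (b / n) then a else m - 1 - a).
    pose proof (same_vertex_shift (x / m) (x mod m) (b mod n)) as H.
    replace (x mod m + x / m * m) with x in H; auto.
    rewrite (Z.div_mod x m) at 1 by lia. lia.
Qed.

(** [sigma] raises [b / n] by one, and the switch of parity branch undoes its reflection; [tau]
    changes the first entry by a multiple of [m]. *)
Lemma repr_same_vertex (p q : pt) : same_vertex m n p q -> repr p = repr q.
Proof.
  induction 1 as [p q [-> | ->] | | | ]; try congruence;
    destruct p as [a b]; unfold repr, tau, sigma; cbn [fst snd].
  - f_equal. destruct (Z.even (b / n)).
    + rewrite <- (Z_mod_plus_full a 1 m). f_equal. lia.
    + rewrite <- (Z_mod_plus_full (m - 1 - (a + m)) 1 m). f_equal. lia.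
  - replace (b + n) with (b + 1 * n) by lia.
    rewrite Z_mod_plus_full, Z_div_plus_full by lia.
    rewrite Z.even_add. f_equal.
    destruct (Z.even (b / n)); cbn; f_equal; lia.
Qed.

Definition interval (k : Z) : list Z := map Z.of_nat (seq 0 (Z.to_nat k)).

Lemma in_interval (k x : Z) : In x (interval k) <-> 0 <= x < k.
Proof.
  unfold interval. rewrite in_map_iff. split.
  - intros (i & <- & Hi%in_seq). lia.
  - intros Hx. exists (Z.to_nat x). rewrite in_seq. lia.
Qed.

Definition board : list (Z * Z) := list_prod (interval m) (interval n).

Lemma in_board (x y : Z) : In (x, y) board <-> 0 <= x < m /\ 0 <= y < n.
Proof. unfold board. rewrite in_prod_iff, !in_interval. reflexivity. Qed.

Lemma repr_in_board (p : pt) : In (repr p) board.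
Proof. apply in_board. split; apply Z.mod_pos_bound; lia. Qed.

Lemma repr_board (x y : Z) : 0 <= x < m /\ 0 <= y < n -> repr (x, y) = (x, y).
Proof.
  intros Hxy. unfold repr; cbn [fst snd]. rewrite Z.div_small by lia. cbn.
  now rewrite !Z.mod_small by lia.
Qed.

Lemma length_board : length board = Z.to_nat (m * n).
Proof.
  unfold board, interval. rewrite length_prod, !length_map, !length_seq.
  rewrite Z2Nat.inj_mul; lia.
Qed.
Lemma NoDup_board : NoDup board.
Proof.
  apply NoDup_list_prod; apply Injective_map_NoDup, seq_NoDup;
    intros i j; apply Nat2Z.inj.
Qed.

(** Injectivity bounds [N] above by the size of the board, surjectivity bounds it below. *)
Lemma lifted_tour_length (w : nat -> pt) (N : nat) :
  lifted_tour m n w N -> N = Z.to_nat (m * n).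
Proof.
  intros (_ & _ & _ & _ & Hinj & Hsurj).
  rewrite <- length_board, <- (length_seq N 0), <- (length_map (fun i => repr (w i))).
  apply Nat.le_antisymm; apply NoDup_incl_length.
  - apply NoDup_map_NoDup_ForallPairs; [|apply seq_NoDup].
    intros i j Hi%in_seq Hj%in_seq Heq. apply Hinj; try lia.
    apply rst_trans with (repr (w i)); [apply same_vertex_repr|].
    rewrite Heq. apply rst_sym, same_vertex_repr.
  - intros p (i & <- & _)%in_map_iff. apply repr_in_board.
  - apply NoDup_board.
  - intros [x y] Hxy%in_board. apply in_map_iff.
    destruct (Hsurj (x, y)) as (i & Hi & H%repr_same_vertex).
    exists i. rewrite in_seq. split; [|lia]. rewrite <- H. apply repr_board, Hxy.
Qed.

Lemma mobius_tour_of_cover (w : nat -> pt) :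
  w 0%nat = (0, 0) ->
  (forall i, 0 <= Z.of_nat i < m * n -> knight_adj (w i) (w (S i))) ->
  w (Z.to_nat (m * n)) = (m - 1, n) \/ w (Z.to_nat (m * n)) = (m - 1, - n) ->
  (forall x y, 0 <= x < m -> 0 <= y < n ->
     exists i, 0 <= Z.of_nat i < m * n /\ same_vertex m n (x, y) (w i)) ->
  mobius_tour m n w (Z.to_nat (m * n)).
Proof.
  intros H0 Hadj Hend Hcov. split; [|exact Hend].
  assert (Hcov' : forall p, exists i,
    (i < Z.to_nat (m * n))%nat /\ same_vertex m n p (w i)).
  { intros p. destruct (repr p) as [x y] eqn:Hp.
    pose proof (repr_in_board p) as Hb. rewrite Hp in Hb. apply in_board in Hb.
    destruct (Hcov x y) as (i & Hi & H); try tauto.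
    exists i. split; [lia|]. apply rst_trans with (x, y); auto.
    rewrite <- Hp. apply same_vertex_repr. }
  split; [nia|]. split; [exact H0|]. split; [|split; [|split; [|exact Hcov']]].
  - intros i Hi. apply Hadj. lia.
  - rewrite H0. destruct Hend as [-> | ->].
    + pose proof (same_vertex_sigma 0 0) as H.
      replace (m - 1 - 0) with (m - 1) in H by lia. apply rst_sym, H.
    + pose proof (same_vertex_sigma (m - 1) (- n)) as H.
      replace (m - 1 - (m - 1)) with 0 in H by lia.
      replace (- n + n) with 0 in H by lia. exact H.
  (* Pigeonhole: a list of [m * n] representatives that contains the whole board has no
     repetition. *)
  - assert (Hnd : NoDup (map (fun i => repr (w i)) (seq 0 (Z.to_nat (m * n))))).
    { apply NoDup_incl_NoDup with board.
      - apply NoDup_board.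
      - rewrite length_map, length_seq, length_board. lia.
      - intros [x y] Hxy%in_board. apply in_map_iff.
        destruct (Hcov' (x, y)) as (i & Hi & H%repr_same_vertex).
        exists i. rewrite in_seq. split; [|lia]. rewrite <- H. apply repr_board, Hxy. }
    intros i j Hi Hj Heq%repr_same_vertex.
    apply NoDup_nth_error with (i := i) (j := j) in Hnd; auto.
    + rewrite length_map, length_seq. exact Hi.
    + rewrite !nth_error_map, !nth_error_seq.
      destruct (Nat.ltb_spec i (Z.to_nat (m * n))); try lia.
      destruct (Nat.ltb_spec j (Z.to_nat (m * n))); try lia.
      cbn. f_equal. exact Heq.
Qed.

(** * The parity obstruction *)

Lemma knight_adj_parity (p q : pt) :
  knight_adj p q -> Z.even (fst q + snd q) = negb (Z.even (fst p + snd p)).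
Proof.
  destruct p as [a b], q as [a' b']; unfold knight_adj; cbn [fst snd]. intros H.
  rewrite Z.negb_even, <- Z.even_succ.
  assert (Hk : exists k, a' + b' = Z.succ (a + b) + 2 * k).
  { assert (Hd : a' + b' = a + b + 1 \/ a' + b' = a + b - 1 \/
                 a' + b' = a + b + 3 \/ a' + b' = a + b - 3) by lia.
    destruct Hd as [-> | [-> | [-> | ->]]]; [exists 0 | exists (-1) | exists 1 | exists (-2)]; lia. }
  destruct Hk as [k ->]. apply Z.even_add_mul_2.
Qed.

Lemma mobius_tour_odd (w : nat -> pt) (N : nat) :
  mobius_tour m n w N -> Z.odd m = true \/ Z.odd n = true.
Proof.
  intros [Htour Hend]. pose proof (lifted_tour_length _ _ Htour) as HN.
  destruct Htour as (_ & H0 & Hadj & _).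
  assert (Hpar : forall i, (i <= N)%nat ->
    Z.even (fst (w i) + snd (w i)) = Z.even (Z.of_nat i)).
  { induction i as [|i IH]; intros Hi; [now rewrite H0|].
    rewrite (knight_adj_parity (w i)) by (apply Hadj; lia).
    rewrite IH by lia. now rewrite Nat2Z.inj_succ, Z.even_succ, Z.negb_even. }
  (* At the endpoint [m - 1 + n] or [m - 1 - n] must have the parity of [m * n]; this fails exactly
     when both are even. *)
  specialize (Hpar N (le_n N)). rewrite HN, Z2Nat.id, Z.even_mul in Hpar by nia.
  rewrite <- HN in Hpar. rewrite <- !Z.negb_even.
  destruct Hend as [He | He]; rewrite He in Hpar; cbn [fst snd] in Hpar;
    rewrite ?Z.even_add, ?Z.even_sub, ?Z.even_opp in Hpar; cbn in Hpar;
    destruct (Z.even m), (Z.even n); auto.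
Qed.

End Quotient.

(** * Walks as lists of displacements, and stacking of cylinders *)

Definition word : Type := list (Z * Z).

Definition add (p d : pt) : pt := (fst p + fst d, snd p + snd d).

Fixpoint dest (p : pt) (u : word) : pt :=
  match u with
  | [] => p
  | d :: u' => dest (add p d) u'
  end.

(* The points left by the successive steps, so the destination is excluded. *)
Fixpoint visits (p : pt) (u : word) : list pt :=
  match u with
  | [] => []
  | d :: u' => p :: visits (add p d) u'
  end.

Definition knight_move (d : Z * Z) : bool :=
  match Z.abs (fst d), Z.abs (snd d) with
  | 1, 2 | 2, 1 => true
  | _, _ => false
  end.

Lemma knight_moveP (d : Z * Z) (p : pt) : knight_move d = true -> knight_adj p (add p d).
Proof.
  destruct d as [a b], p as [x y]. unfold knight_move, knight_adj, add; cbn [fst snd].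
  replace (x - (x + a)) with (- a) by lia. replace (y - (y + b)) with (- b) by lia.
  rewrite !Z.abs_opp.
  destruct (Z.abs a) as [|[[]|[]|]|], (Z.abs b) as [|[[]|[]|]|]; try discriminate; auto.
Qed.

Lemma add_add_comm (p d e : pt) : add (add p d) e = add (add p e) d.
Proof. unfold add; cbn. f_equal; lia. Qed.

Lemma dest_app (u v : word) : forall p, dest p (u ++ v) = dest (dest p u) v.
Proof. induction u as [|e u IH]; intros p; cbn; auto. Qed.

Lemma dest_add (u : word) : forall p d, dest (add p d) u = add (dest p u) d.
Proof.
  induction u as [|e u IH]; intros p d; cbn [dest]; [reflexivity|].
  now rewrite <- IH, add_add_comm.
Qed.

Lemma visits_app (u v : word) : forall p, visits p (u ++ v) = visits p u ++ visits (dest p u) v.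
Proof. induction u as [|e u IH]; intros p; cbn; [reflexivity|]. now rewrite IH. Qed.

Lemma visits_add (u : word) : forall p d,
  visits (add p d) u = map (fun q => add q d) (visits p u).
Proof.
  induction u as [|e u IH]; intros p d; cbn [visits map]; [reflexivity|].
  now rewrite <- IH, add_add_comm.
Qed.

Lemma in_visits_firstn (u : word) : forall p q, In q (visits p u) ->
  exists i, (i < length u)%nat /\ dest p (firstn i u) = q.
Proof.
  induction u as [|e u IH]; cbn; intros p q; [tauto|]. intros [<- | H].
  - exists 0%nat. split; [lia | reflexivity].
  - apply IH in H as (i & Hi & H). exists (S i). split; [lia | exact H].
Qed.

Lemma dest_firstn_succ (u : word) : forall p i, (i < length u)%nat ->
  exists d, In d u /\ dest p (firstn (S i) u) = add (dest p (firstn i u)) d.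
Proof.
  induction u as [|e u IH]; cbn [length]; intros p i Hi; [lia|].
  destruct i as [|i]; cbn.
  - exists e. auto.
  - destruct (IH (add p e) i) as (d & Hd & H); [lia|]. exists d. split; [auto | exact H].
Qed.

(* A knight's path through all cells of the cylinder of circumference [m] with rows
   [0 <= y < h] that starts at [(0,0)]; its last step leaves the cylinder for [(t,h)]. *)
Record block (m h t : Z) (u : word) : Prop := {
  block_moves : forallb knight_move u = true;
  block_length : Z.of_nat (length u) = m * h;
  block_dest : dest (0, 0) u = (t, h);
  block_cover : forall x y, 0 <= y < h -> exists q, In (x + q * m, y) (visits (0, 0) u) }.

(** The lower path leaves for [(0, h)], so the upper one is its own translate by [(0, h)]. *)
Lemma block_app (m h h' t : Z) (u v : word) :
  0 <= h -> block m h 0 u -> block m h' t v -> block m (h + h') t (u ++ v).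
Proof.
  intros Hh [Hm Hl Hd Hc] [Hm' Hl' Hd' Hc'].
  assert (H0 : (0, h) = add (0, 0) (0, h)) by reflexivity.
  split.
  - now rewrite forallb_app, Hm, Hm'.
  - rewrite length_app. lia.
  - rewrite dest_app, Hd, H0, dest_add, Hd'. unfold add; cbn. f_equal; lia.
  - intros x y Hy. rewrite visits_app, Hd.
    destruct (Z_lt_le_dec y h) as [H|H].
    + destruct (Hc x y) as [q Hq]; [lia|]. exists q. apply in_or_app. now left.
    + destruct (Hc' x (y - h)) as [q Hq]; [lia|]. exists q. apply in_or_app. right.
      rewrite H0, visits_add. apply in_map_iff. exists (x + q * m, y - h).
      split; [|exact Hq]. unfold add; cbn. f_equal; lia.
Qed.

Lemma block_iter (m h : Z) (u : word) : 0 <= h -> block m h 0 u ->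
  forall k : nat, exists v, block m (Z.of_nat k * h) 0 v.
Proof.
  intros Hh Hu. induction k as [|k [v IH]].
  - exists []. split; cbn; auto; lia.
  - exists (u ++ v). replace (Z.of_nat (S k) * h) with (h + Z.of_nat k * h) by lia.
    now apply block_app.
Qed.

(** The path stays a cover of the board because within the rows [0 <= y < n] the cylinder identifies
    cells by powers of [tau] only; [sigma] enters just to close the walk. *)
Lemma mobius_tour_of_block (m n : Z) (u : word) : 0 < m -> 0 < n ->
  block m n (m - 1) u -> exists w N, mobius_tour m n w N.
Proof.
  intros Hm Hn [Hmv Hl Hd Hc].
  exists (fun i => dest (0, 0) (firstn i u)), (Z.to_nat (m * n)).
  apply mobius_tour_of_cover; auto.
  - intros i Hi. destruct (dest_firstn_succ u (0, 0) i) as (d & Hin & ->); [lia|].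
    apply knight_moveP. rewrite forallb_forall in Hmv. auto.
  - left. rewrite <- Hl, Nat2Z.id, firstn_all. exact Hd.
  - intros x y _ Hy. destruct (Hc x y Hy) as [q Hq].
    apply in_visits_firstn in Hq as (i & Hi & Hq).
    exists i. split; [lia|]. rewrite Hq. apply rst_sym, same_vertex_shift.
Qed.

(** * Families of walks with repeated strands, checked uniformly in [k] *)

(* A family of walks: in the [k]-th member the [Rightward] and [Leftward] words, which move
   by [(p,0)] and [(-p,0)], are repeated [k] times. *)
Inductive segment : Type :=
| Fixed (u : word)
| Rightward (u : word)
| Leftward (u : word).

Definition expand (k : nat) (s : segment) : word :=
  match s with
  | Fixed u => u
  | Rightward u | Leftward u => concat (repeat u k)
  end.

Definition walk (k : nat) (l : list segment) : word := flat_map (expand k) l.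

Definition strand_shift (p : Z) (s : segment) : Prop :=
  match s with
  | Fixed _ => True
  | Rightward u => dest (0, 0) u = (p, 0)
  | Leftward u => dest (0, 0) u = (- p, 0)
  end.

Fixpoint net (l : list segment) : Z :=
  match l with
  | [] => 0
  | Fixed _ :: l' => net l'
  | Rightward _ :: l' => net l' + 1
  | Leftward _ :: l' => net l' - 1
  end.

(* The cells of the [k]-th walk on the cylinder of circumference [m = m0 + p * k], without
   reference to [k].  If the [k = 0] walk is at [c] after [b] net strands, the [k]-th one is at
   [c + (b * p * k, 0)], which is [c - (b * m0, 0)] modulo [m].  A tagged cell [(true, q)]
   stands for the cells [q + (p * i, 0)] with [0 <= i < k]; a leftward strand is enumerated
   backwards, whence the [p - (b - 1) * m0]. *)
Fixpoint cells (m0 p : Z) (c : pt) (b : Z) (l : list segment) : list (bool * pt) :=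
  match l with
  | [] => []
  | Fixed u :: l' =>
      map (fun q => (false, add q (- b * m0, 0))) (visits c u)
      ++ cells m0 p (dest c u) b l'
  | Rightward u :: l' =>
      map (fun q => (true, add q (- b * m0, 0))) (visits c u)
      ++ cells m0 p c (b + 1) l'
  | Leftward u :: l' =>
      map (fun q => (true, add q (p - (b - 1) * m0, 0))) (visits c u)
      ++ cells m0 p c (b - 1) l'
  end.

Lemma add_zero (p : pt) : add p (0, 0) = p.
Proof. destruct p as [a b]. unfold add; cbn. f_equal; lia. Qed.

Lemma add_assoc (p d e : pt) : add (add p d) e = add p (add d e).
Proof. unfold add; cbn. f_equal; lia. Qed.

Lemma dest_shift (u : word) (c : pt) : dest c u = add c (dest (0, 0) u).
Proof.
  assert (Hc : add (0, 0) c = c) by (destruct c; reflexivity).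
  rewrite <- Hc at 1. rewrite dest_add.
  unfold add; cbn. f_equal; lia.
Qed.

Lemma dest_repeat (u : word) (d : Z) : dest (0, 0) u = (d, 0) ->
  forall k c, dest c (concat (repeat u k)) = add c (d * Z.of_nat k, 0).
Proof.
  intros Hu. induction k as [|k IH]; intros c.
  - cbn [repeat concat dest]. rewrite Z.mul_0_r. symmetry. apply add_zero.
  - cbn [repeat concat]. rewrite dest_app, IH, (dest_shift u c), Hu, add_assoc.
    unfold add; cbn [fst snd]. f_equal; lia.
Qed.

Lemma visits_repeat (u : word) (d : Z) : dest (0, 0) u = (d, 0) ->
  forall k c q i, In q (visits c u) -> 0 <= i < Z.of_nat k ->
  In (add q (d * i, 0)) (visits c (concat (repeat u k))).
Proof.
  intros Hu. induction k as [|k IH]; intros c q i Hq Hi; [lia|].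
  cbn [repeat concat]. rewrite visits_app. apply in_or_app.
  destruct (Z.eq_dec i 0) as [->|Hi0].
  - left. now rewrite Z.mul_0_r, add_zero.
  - right. rewrite (dest_shift u c), Hu, visits_add. apply in_map_iff.
    exists (add q (d * (i - 1), 0)). split; [|apply IH; auto; lia].
    rewrite add_assoc. unfold add; cbn [fst snd]. f_equal; lia.
Qed.

Lemma dest_walk (p : Z) (k : nat) (l : list segment) : Forall (strand_shift p) l ->
  forall c, dest c (walk k l) = add (dest c (walk 0 l)) (net l * p * Z.of_nat k, 0).
Proof.
  induction 1 as [|s l Hs Hl IH]; intros c; cbn [walk flat_map net].
  - cbn [dest]. symmetry. apply add_zero.
  - fold (walk k l) (walk 0 l). rewrite !dest_app. destruct s as [u|u|u]; cbn [expand].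
    + apply IH.
    + rewrite (dest_repeat _ _ Hs), dest_add, IH, add_assoc. cbn [repeat concat dest].
      unfold add; cbn [fst snd]. f_equal; lia.
    + rewrite (dest_repeat _ _ Hs), dest_add, IH, add_assoc. cbn [repeat concat dest].
      unfold add; cbn [fst snd]. f_equal; lia.
Qed.

(** The length is affine in [k], hence known from [k = 0] and [k = 1]; terms are moved across to
    avoid subtraction in [nat]. *)
Lemma length_walk (k : nat) (l : list segment) :
  (length (walk k l) + k * length (walk 0 l) = length (walk 0 l) + k * length (walk 1 l))%nat.
Proof.
  assert (Hr : forall u : word, length (concat (repeat u k)) = (k * length u)%nat).
  { intros u. induction k as [|j IH]; cbn; rewrite ?length_app; lia. }
  induction l as [|s l IH]; [cbn; lia|].
  unfold walk in *. cbn [flat_map]. rewrite !length_app.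
  destruct s as [u|u|u]; cbn [expand]; rewrite ?Hr; cbn [repeat concat length];
    rewrite ?app_nil_r; lia.
Qed.

Lemma moves_walk (k : nat) (l : list segment) :
  forallb knight_move (walk 1 l) = true -> forallb knight_move (walk k l) = true.
Proof.
  rewrite !forallb_forall. intros H d (s & Hs & Hd)%in_flat_map.
  apply H, in_flat_map. exists s. split; [exact Hs|].
  assert (Hr : forall u : word, In d (concat (repeat u k)) -> In d (concat (repeat u 1))).
  { intros u (v & Hv & Hdv)%in_concat. apply repeat_spec in Hv as ->.
    cbn. now rewrite app_nil_r. }
  destruct s as [u|u|u]; cbn [expand] in *; auto.
Qed.

(** With [m = m0 + p * k], the lead [b * p * k] over the walk for [k = 0] equals [b * m - b * m0].
    The witness [j] is therefore the number [b] of full turns. *)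
Lemma cells_walk (m0 p : Z) (k : nat) (l : list segment) : Forall (strand_shift p) l ->
  forall c b (str : bool) q i, In (str, q) (cells m0 p c b l) ->
  (str = true -> 0 <= i < Z.of_nat k) ->
  exists j, In (add q ((if str then p * i else 0) + j * (m0 + p * Z.of_nat k), 0))
               (visits (add c (b * p * Z.of_nat k, 0)) (walk k l)).
Proof.
  induction 1 as [|s l Hs Hl IH]; intros c b str q i Hin Hi; [destruct Hin|].
  cbn [walk flat_map]. fold (walk k l). rewrite visits_app.
  destruct s as [u|u|u]; cbn [cells expand] in *;
    apply in_app_or in Hin as [(q0 & [= <- <-] & Hq0)%in_map_iff | Hin].
  - exists b. apply in_or_app. left. rewrite visits_add. apply in_map_iff.
    exists q0. split; [|exact Hq0].
    unfold add; cbn [fst snd]. f_equal; lia.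
  - apply IH with (i := i) in Hin as [j Hj]; [|exact Hi].
    exists j. apply in_or_app. right. rewrite dest_add. exact Hj.
  - exists b. apply in_or_app. left. rewrite visits_add. apply in_map_iff.
    exists (add q0 (p * i, 0)). split; [|apply visits_repeat; auto].
    unfold add; cbn [fst snd]. f_equal; lia.
  - apply IH with (i := i) in Hin as [j Hj]; [|exact Hi].
    exists j. apply in_or_app. right. rewrite (dest_repeat _ _ Hs), add_assoc.
    replace (add (b * p * Z.of_nat k, 0) (p * Z.of_nat k, 0))
      with ((b + 1) * p * Z.of_nat k, 0); [exact Hj|].
    unfold add; cbn [fst snd]. f_equal; lia.
  - specialize (Hi eq_refl).
    (* Counted from its left end, copy [i] of a leftward strand is traversed in repetition
       [k - 1 - i], and that end lies [b - 1] turns on. *)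
    exists (b - 1). apply in_or_app. left. rewrite visits_add. apply in_map_iff.
    exists (add q0 (- p * (Z.of_nat k - 1 - i), 0)).
    split; [|apply visits_repeat; auto; lia].
    unfold add; cbn [fst snd]. f_equal; lia.
  - apply IH with (i := i) in Hin as [j Hj]; [|exact Hi].
    exists j. apply in_or_app. right. rewrite (dest_repeat _ _ Hs), add_assoc.
    replace (add (b * p * Z.of_nat k, 0) (- p * Z.of_nat k, 0))
      with ((b - 1) * p * Z.of_nat k, 0); [exact Hj|].
    unfold add; cbn [fst snd]. f_equal; lia.
Qed.

Definition pt_eqb (p q : pt) : bool := (fst p =? fst q) && (snd p =? snd q).

Definition mem (c : bool * pt) (l : list (bool * pt)) : bool :=
  existsb (fun c' => Bool.eqb (fst c) (fst c') && pt_eqb (snd c) (snd c')) l.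

Lemma memP (c : bool * pt) (l : list (bool * pt)) : mem c l = true -> In c l.
Proof.
  intros (c' & Hin & Hc)%existsb_exists.
  apply andb_true_iff in Hc as [H1%eqb_prop H2].
  apply andb_true_iff in H2 as [H2%Z.eqb_eq H3%Z.eqb_eq].
  replace c with c'; [exact Hin|].
  destruct c as [s [x y]], c' as [s' [x' y']]; cbn in *; congruence.
Qed.

(* In row [y] the fixed cells fill [f - m0, f) and the strands [f, f + p), so that for every
   [k] together they fill a period [f - m0, f + p * k). *)
Definition tiles (m0 p h : Z) (fs : list Z) (cs : list (bool * pt)) : bool :=
  forallb (fun y => let f := nth (Z.to_nat y) fs 0 in
    forallb (fun i => mem (false, (f - m0 + i, y)) cs) (interval m0) &&
    forallb (fun i => mem (true, (f + i, y)) cs) (interval p)) (interval h).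

(** Apart from the equations for [m] and [t'], no hypothesis mentions [k]: one computation settles a
    whole residue class of [m]. *)
Lemma block_walk (m0 p h t : Z) (fs : list Z) (l : list segment) (k : nat) (m t' : Z) :
  m = m0 + p * Z.of_nat k -> t' = t + net l * p * Z.of_nat k ->
  0 < m0 -> 0 < p ->
  Forall (strand_shift p) l ->
  forallb knight_move (walk 1 l) = true ->
  Z.of_nat (length (walk 0 l)) = m0 * h ->
  Z.of_nat (length (walk 1 l)) = (m0 + p) * h ->
  dest (0, 0) (walk 0 l) = (t, h) ->
  tiles m0 p h fs (cells m0 p (0, 0) 0 l) = true ->
  block m h t' (walk k l).
Proof.
  intros Hmk -> Hm0 Hp Hs Hmv Hl0 Hl1 Hd Ht. split.
  - now apply moves_walk.
  - pose proof (length_walk k l). subst m. nia.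
  - rewrite (dest_walk p) by exact Hs. rewrite Hd. unfold add; cbn [fst snd]. f_equal; lia.
  - intros x y Hy.
    unfold tiles in Ht. rewrite forallb_forall in Ht.
    specialize (Ht y (proj2 (in_interval h y) Hy)). cbv zeta in Ht.
    set (f := nth (Z.to_nat y) fs 0) in Ht.
    apply andb_true_iff in Ht as [Hf Hg]. rewrite forallb_forall in Hf, Hg.
    assert (Hm : 0 < m) by (rewrite Hmk; nia).
    (* [r] is the position of [x] in the period that begins at [f - m0]: a fixed cell if [r < m0],
       otherwise offset [r'] in copy [i] of the strands. *)
    pose proof (Z.mod_pos_bound (x - (f - m0)) m Hm) as Hr.
    pose proof (Z.div_mod (x - (f - m0)) m ltac:(lia)) as Hx.
    set (r := (x - (f - m0)) mod m) in *. set (e := (x - (f - m0)) / m) in *.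
    destruct (Z_lt_le_dec r m0) as [Hrm|Hrm].
    + specialize (Hf r (proj2 (in_interval m0 r) ltac:(lia))). apply memP in Hf.
      apply (cells_walk _ _ k _ Hs) with (i := 0) in Hf as [j Hj]; [|discriminate].
      rewrite <- Hmk in Hj. exists (j - e).
      replace (x + (j - e) * m, y) with (add (f - m0 + r, y) (0 + j * m, 0)).
      * exact Hj.
      * unfold add; cbn [fst snd]. f_equal; nia.
    + pose proof (Z.mod_pos_bound (r - m0) p Hp) as Hr'.
      pose proof (Z.div_mod (r - m0) p ltac:(lia)) as Hx'.
      set (r' := (r - m0) mod p) in *. set (i := (r - m0) / p) in *.
      specialize (Hg r' (proj2 (in_interval p r') ltac:(lia))). apply memP in Hg.
      apply (cells_walk _ _ k _ Hs) with (i := i) in Hg as [j Hj].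
      * rewrite <- Hmk in Hj. exists (j - e).
        replace (x + (j - e) * m, y) with (add (f + r', y) (p * i + j * m, 0)).
        -- exact Hj.
        -- unfold add; cbn [fst snd]. f_equal; nia.
      * intros _. nia.
Qed.

Lemma block_small (m h t : Z) (u : word) :
  0 < m ->
  forallb knight_move u = true ->
  Z.of_nat (length u) = m * h ->
  dest (0, 0) u = (t, h) ->
  forallb (fun c => existsb (fun q => pt_eqb (fst q mod m, snd q) c) (visits (0, 0) u))
    (board m h) = true ->
  block m h t u.
Proof.
  intros Hm Hmv Hl Hd Hc. split; auto. intros x y Hy.
  rewrite forallb_forall in Hc.
  pose proof (Z.mod_pos_bound x m Hm) as Hx.
  specialize (Hc (x mod m, y) (proj2 (in_board m h _ _) (conj Hx Hy))).
  apply existsb_exists in Hc as ([a b] & Hin & Hq).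
  apply andb_true_iff in Hq as [Hq1%Z.eqb_eq Hq2%Z.eqb_eq]; cbn [fst snd] in *. subst b.
  exists (a / m - x / m).
  replace (x + (a / m - x / m) * m) with a; [exact Hin|].
  pose proof (Z.div_mod a m). pose proof (Z.div_mod x m). lia.
Qed.

(** * Explicit schemes and the blocks they give *)

Definition scheme_three : list segment :=
  [Fixed [(1, 2)];
   Rightward [(-2, -1); (2, -1); (1, 2)];
   Fixed [(-2, -1); (1, 2)]].

Definition scheme_four : list segment :=
  [Fixed [(2, 1)];
   Rightward [(1, 2); (-2, -1); (1, -2); (2, 1)];
   Fixed [(1, 2); (1, -2)];
   Rightward [(1, 2); (1, -2)];
   Fixed [(1, 2); (1, -2); (1, 2); (-2, -1); (-1, -2)];
   Leftward [(-1, 2); (-1, -2)];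
   Fixed [(-1, 2); (-1, -2); (-1, 2); (1, 2)]].

(** One leftward and one rightward strand cancel, so the exit column stays [0] for all [k]. The
    shifting schemes have net strand number 1, so that their exit column grows with [m]. *)
Definition scheme_return_odd : list segment :=
  [Fixed [(2, 1); (-1, 2); (-2, -1); (-1, -2)];
   Leftward [(2, 1); (-1, 2); (-2, -1); (-1, -2)];
   Fixed [(2, 1); (-2, 1); (2, 1); (1, -2); (-2, -1); (1, 2)];
   Rightward [(2, 1); (1, -2); (-2, -1); (1, 2)];
   Fixed [(2, 1); (-2, 1)]].

Definition scheme_return_even : list segment :=
  [Fixed [(2, 1); (-1, 2); (-2, -1); (-1, -2)];
   Leftward [(2, 1); (-1, 2); (-2, -1); (-1, -2)];
   Fixed [(-1, 2); (2, 1); (1, -2); (-2, 1); (-1, -2); (2, 1); (1, 2); (1, -2);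
     (-2, -1); (1, 2)];
   Rightward [(2, 1); (1, -2); (-2, -1); (1, 2)];
   Fixed [(2, 1); (-2, 1)]].

Definition scheme_five : list segment :=
  [Fixed [(2, 1); (-1, 2); (-2, 1); (1, -2); (1, -2); (2, 1); (-2, 1); (1, -2);
     (2, 1)];
   Rightward [(-1, 2); (-2, 1); (1, -2); (1, -2); (2, 1)];
   Fixed [(1, 2); (-2, 1); (-1, -2); (-1, 2); (2, -1); (-1, 2)]].

Definition scheme_six : list segment :=
  [Fixed [(2, 1); (-2, 1); (1, -2); (2, 1); (-1, 2)];
   Rightward [(1, 2); (-2, -1); (2, -1); (1, 2); (-2, -1); (-1, -2); (1, -2); (2, 1);
     (-2, 1); (1, -2); (2, 1); (-1, 2)];
   Fixed [(1, 2); (-2, -1); (1, -2); (1, 2); (2, 1); (-1, -2); (-2, 1); (-1, -2);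
     (1, -2); (2, 1); (-1, 2); (1, 2); (-2, 1)]].

Ltac by_scheme m0 p t fs s k :=
  exists (walk k s); apply (block_walk m0 p _ t fs);
  [ lia | let v := eval vm_compute in (net s) in change (net s) with v; lia | .. ];
  try reflexivity; repeat constructor.

Ltac by_word u := exists u; apply block_small; [reflexivity.. | vm_compute; reflexivity].

Lemma block_three (m : Z) : 0 < m -> exists u, block m 3 (m - 1) u.
Proof. intros Hm. by_scheme 1 1 0 [1; -1; 1] scheme_three (Z.to_nat (m - 1)). Qed.

(** Parity forces [m] to be odd: [4 * m] steps lead to [(m - 1, 4)]. Hence the strands have period
    2; the scheme starts at [m = 3], and [m = 1] is done by hand. *)
Lemma block_four (m : Z) : 0 < m -> Z.odd m = true -> exists u, block m 4 (m - 1) u.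
Proof.
  intros Hm [j ->]%Z.odd_spec. destruct (Z.eq_dec j 0) as [->|Hj].
  - by_word [(1, 2); (2, -1); (-1, 2); (-2, 1)].
  - by_scheme 3 2 2 [2; 1; 1; 2] scheme_four (Z.to_nat (j - 1)).
Qed.

Lemma block_five (m : Z) : 0 < m -> exists u, block m 5 (m - 1) u.
Proof.
  intros Hm. destruct (Z.eq_dec m 1) as [->|H1]; [|destruct (Z.eq_dec m 2) as [->|H2]].
  - by_word [(1, 2); (2, -1); (1, 2); (-2, 1); (-2, 1)].
  - by_word [(1, 2); (1, 2); (2, -1); (1, -2); (2, -1); (1, 2); (-2, -1); (-1, 2); (-2, 1); (-2, 1)].
  - by_scheme 3 1 2 [3; 4; 2; 3; 1] scheme_five (Z.to_nat (m - 3)).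
Qed.

Lemma block_six (m : Z) : 0 < m -> Z.odd m = true -> exists u, block m 6 (m - 1) u.
Proof.
  intros Hm [j ->]%Z.odd_spec. destruct (Z.eq_dec j 0) as [->|Hj].
  - by_word [(1, 2); (2, -1); (1, 2); (-1, 2); (-2, -1); (-1, 2)].
  - by_scheme 3 2 2 [2; 4; 1; 2; 1; 3] scheme_six (Z.to_nat (j - 1)).
Qed.

Lemma block_return (m : Z) : 0 < m -> exists u, block m 4 0 u.
Proof.
  intros Hm. destruct (Z.Even_or_Odd m) as [[j ->]|[j ->]].
  - destruct (Z.eq_dec j 1) as [->|Hj].
    + by_word [(1, 2); (2, 1); (1, -2); (2, 1); (-1, -2); (-2, 1); (-1, 2); (-2, 1)].
    + by_scheme 4 2 0 [4; 6; 3; 5] scheme_return_even (Z.to_nat (j - 2)).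
  - destruct (Z.eq_dec j 0) as [->|Hj].
    + by_word [(1, 2); (2, -1); (-1, 2); (-2, 1)].
    + by_scheme 3 2 0 [3; 5; 2; 4] scheme_return_odd (Z.to_nat (j - 1)).
Qed.

(** * Boards with one or two rows *)

Lemma same_vertex_row (m n x a y j : Z) : x = a + j * m -> same_vertex m n (x, y) (a, y).
Proof. intros ->. apply same_vertex_shift. Qed.

Lemma same_vertex_up (m n x y a b j : Z) :
  b = y + n -> x + a = m - 1 + j * m -> same_vertex m n (x, y) (a, b).
Proof.
  intros -> H. apply rst_trans with (m - 1 - a, y); [apply same_vertex_row with j; lia|].
  replace a with (m - 1 - (m - 1 - a)) at 2 by lia. apply same_vertex_sigma.
Qed.

Lemma same_vertex_down (m n x y a b j : Z) :
  b = y - n -> x + a = m - 1 + j * m -> same_vertex m n (x, y) (a, b).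
Proof. intros -> H. apply rst_sym, same_vertex_up with j; lia. Qed.

(** Rows 1 and -1 are both reflected copies of the only row, so from [i = 2] on the zigzag meets
    column [m - i]; the first two points supply columns [0] and [m - 1]. *)
Definition tour_one (i : nat) : pt :=
  match i with
  | O => (0, 0)
  | 1%nat => (-1, 2)
  | _ => (Z.of_nat i - 1, if Nat.even i then 1 else -1)
  end.

Lemma mobius_tour_one (m : Z) : 1 < m -> exists w N, mobius_tour m 1 w N.
Proof.
  intros Hm. exists tour_one, (Z.to_nat (m * 1)).
  apply mobius_tour_of_cover; auto; try lia.
  - intros [|[|i]] _; [unfold knight_adj; cbn; lia | unfold knight_adj; cbn; lia |].
    unfold tour_one. rewrite (Nat.even_succ (S (S i))), <- Nat.negb_even.
    unfold knight_adj; cbn [fst snd].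
    destruct (Nat.even (S (S i))); cbn [negb]; lia.
  - destruct (Z.to_nat (m * 1)) as [|[|i]] eqn:Hi; [lia | lia |].
    unfold tour_one. destruct (Nat.even (S (S i))); [left | right]; f_equal; lia.
  - intros x y Hx Hy. replace y with 0 by lia.
    destruct (Z.eq_dec x 0) as [->|H0]; [|destruct (Z.eq_dec x (m - 1)) as [->|H1]].
    + exists 0%nat. split; [lia | apply rst_refl].
    + exists 1%nat. split; [lia|]. apply rst_trans with (0, 1).
      * apply same_vertex_up with 0; lia.
      * apply same_vertex_up with (-1); lia.
    + exists (Z.to_nat (m - x)). split; [lia|].
      destruct (Z.to_nat (m - x)) as [|[|i]] eqn:Hi; [lia | lia |]. unfold tour_one.
      destruct (Nat.even (S (S i))).
      * apply same_vertex_up with 0; lia.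
      * apply same_vertex_down with 0; lia.
Qed.

(* With [t] as coordinate of the vertex [(-2t, t mod 2)], the vertices form a cycle of length
   [2m]; this tour runs once around it, and at [t = 3k] a step across the upper or lower
   side, instead of one between the two rows, reverses the direction of the lift. *)
Definition tour_two_1mod4 (k : Z) (i : nat) : pt :=
  let t := Z.of_nat i in
  if t <=? 3 * k then (- 2 * t, t mod 2)
  else (2 * t - 12 * k - 4, (if Z.odd k then 2 else -2) + t mod 2).

Ltac mod2_bounds t :=
  let H := fresh in let H' := fresh in
  pose proof (Z.mod_pos_bound t 2 eq_refl) as H;
  pose proof (Z.div_mod t 2 ltac:(lia)) as H'.

Lemma mobius_tour_two_1mod4 (k : Z) : 0 <= k ->
  exists w N, mobius_tour (4 * k + 1) 2 w N.
Proof.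
  intros Hk. set (m := 4 * k + 1).
  (* The parity of [k] is the row of the lift at [t = 3 * k], which decides between the upper and
     the lower side. *)
  assert (Hodd : if Z.odd k then exists j, k = 2 * j + 1 else exists j, k = 2 * j).
  { destruct (Z.odd k) eqn:H; [now apply Z.odd_spec|].
    apply Z.even_spec. now rewrite <- Z.negb_odd, H. }
  exists (tour_two_1mod4 k), (Z.to_nat (m * 2)).
  apply mobius_tour_of_cover; try lia.
  - unfold tour_two_1mod4. change (Z.of_nat 0) with 0. destruct (Z.leb_spec 0 (3 * k)); [reflexivity | lia].
  - intros i Hi. unfold tour_two_1mod4. rewrite Nat2Z.inj_succ.
    set (t := Z.of_nat i) in *. unfold knight_adj.
    mod2_bounds t. mod2_bounds (Z.succ t).
    destruct (Z.leb_spec t (3 * k)), (Z.leb_spec (Z.succ t) (3 * k)); cbn [fst snd];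
      destruct (Z.odd k); destruct Hodd as [j Hj]; lia.
  - unfold tour_two_1mod4. rewrite Z2Nat.id by lia.
    destruct (Z.leb_spec (m * 2) (3 * k)); [lia|].
    mod2_bounds (m * 2).
    destruct (Z.odd k); [left | right]; f_equal; lia.
  - intros x y Hx Hy.
    (* The coordinate [t = y + 2 * j] of [(x, y)] has to solve [x + 2 * t = 0] modulo [m]. Since
       [4 * k = -1] modulo [m], this gives [j = k * (x + 2 * y)]. *)
    pose proof (Z.mod_pos_bound (k * (x + 2 * y)) m ltac:(lia)) as Hr.
    pose proof (Z.div_mod (k * (x + 2 * y)) m ltac:(lia)) as Hd.
    set (j := (k * (x + 2 * y)) mod m) in *. set (e := k * (x + 2 * y) / m) in *.
    assert (He : x + 2 * (y + 2 * j) = m * (x + 2 * y - 4 * e)) by (unfold m in *; nia).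
    exists (Z.to_nat (y + 2 * j)). split; [lia|].
    unfold tour_two_1mod4. rewrite Z2Nat.id by lia.
    replace ((y + 2 * j) mod 2) with y
      by (rewrite Z.mul_comm, Z_mod_plus_full, Z.mod_small; lia).
    destruct (Z.leb_spec (y + 2 * j) (3 * k)).
    + apply same_vertex_row with (x + 2 * y - 4 * e). lia.
    (* Past the crossing, [-2 * t] and the first coordinate of the lift add up to
       [-12 * k - 4 = -3 * m - 1], as a reflection requires. *)
    + destruct (Z.odd k).
      * apply same_vertex_up with (x + 2 * y - 4 * e - 4); unfold m in *; lia.
      * apply same_vertex_down with (x + 2 * y - 4 * e - 4); unfold m in *; lia.
Qed.

(* Here the cycle [(2t, t mod 2)] is cut at [t = k], [5k + 2] and [7k + 5] and the two middle
   arcs are exchanged. *)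
Definition tour_two_3mod4 (k : Z) (i : nat) : pt :=
  let t := Z.of_nat i in
  if t <=? k then (2 * t, t mod 2)
  else if t <=? 3 * k + 3 then (4 * k + 4 - 2 * t, (if Z.odd k then 2 else -2) + t mod 2)
  else if t <=? 7 * k + 5 then (2 * t - 8 * k - 9, (t + 1) mod 2)
  else (20 * k + 14 - 2 * t, 2 + t mod 2).

Lemma mobius_tour_two_3mod4 (k : Z) : 0 <= k ->
  exists w N, mobius_tour (4 * k + 3) 2 w N.
Proof.
  intros Hk. set (m := 4 * k + 3).
  assert (Hodd : if Z.odd k then exists j, k = 2 * j + 1 else exists j, k = 2 * j).
  { destruct (Z.odd k) eqn:H; [now apply Z.odd_spec|].
    apply Z.even_spec. now rewrite <- Z.negb_odd, H. }
  exists (tour_two_3mod4 k), (Z.to_nat (m * 2)).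
  apply mobius_tour_of_cover; try lia.
  - unfold tour_two_3mod4. change (Z.of_nat 0) with 0. destruct (Z.leb_spec 0 k); [reflexivity | lia].
  - intros i Hi. unfold tour_two_3mod4. rewrite Nat2Z.inj_succ.
    set (t := Z.of_nat i) in *. unfold knight_adj.
    mod2_bounds t. mod2_bounds (t + 1). replace (Z.succ t) with (t + 1) by lia. mod2_bounds (t + 1 + 1).
    destruct (Z.leb_spec t k), (Z.leb_spec (t + 1) k); try lia;
    destruct (Z.leb_spec t (3 * k + 3)), (Z.leb_spec (t + 1) (3 * k + 3)); try lia;
    destruct (Z.leb_spec t (7 * k + 5)), (Z.leb_spec (t + 1) (7 * k + 5)); try lia;
    cbn [fst snd]; destruct (Z.odd k); destruct Hodd as [j Hj]; lia.
  - unfold tour_two_3mod4. rewrite Z2Nat.id by lia.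
    destruct (Z.leb_spec (m * 2) k); [lia|].
    destruct (Z.leb_spec (m * 2) (3 * k + 3)); [lia|].
    destruct (Z.leb_spec (m * 2) (7 * k + 5)); [lia|].
    mod2_bounds (m * 2). left; f_equal; lia.
  - intros x y Hx Hy.
    (* Here [2 * t = x] modulo [m] is solved with [k + 1] as the inverse of 4, because
       [4 * (k + 1) = m + 1]. *)
    pose proof (Z.mod_pos_bound ((k + 1) * (x - 2 * y)) m ltac:(lia)) as Hr.
    pose proof (Z.div_mod ((k + 1) * (x - 2 * y)) m ltac:(lia)) as Hd.
    set (j := ((k + 1) * (x - 2 * y)) mod m) in *.
    set (e := (k + 1) * (x - 2 * y) / m) in *.
    assert (He : 2 * (y + 2 * j) = x + m * (x - 2 * y - 4 * e)) by (unfold m in *; nia).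
    assert (Ht : (y + 2 * j) mod 2 = y)
      by (rewrite Z.mul_comm, Z_mod_plus_full, Z.mod_small; lia).
    set (t := y + 2 * j) in *. set (q := x - 2 * y - 4 * e) in *.
    assert (Hs : exists s, 0 <= s < m * 2 /\ same_vertex m 2 (x, y) (tour_two_3mod4 k (Z.to_nat s))).
    2: { destruct Hs as (s & Hs & H). exists (Z.to_nat s). split; [lia | exact H]. }
    unfold tour_two_3mod4.
    (* The exchanged arcs have lengths [4 * k + 2] and [2 * k + 3]; each is displaced by the length
       of the other. *)
    destruct (Z_le_gt_dec t k); [|destruct (Z_le_gt_dec t (5 * k + 2));
      [|destruct (Z_le_gt_dec t (7 * k + 5))]].
    + exists t. split; [lia|]. rewrite Z2Nat.id by lia.
      destruct (Z.leb_spec t k); [|lia]. rewrite Ht.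
      apply same_vertex_row with (- q). lia.
    + exists (t + 2 * k + 3). split; [lia|]. rewrite Z2Nat.id by lia.
      destruct (Z.leb_spec (t + 2 * k + 3) k); [lia|].
      destruct (Z.leb_spec (t + 2 * k + 3) (3 * k + 3)); [lia|].
      destruct (Z.leb_spec (t + 2 * k + 3) (7 * k + 5)); [|lia].
      replace ((t + 2 * k + 3 + 1) mod 2) with y.
      2: { replace (t + 2 * k + 3 + 1) with (t + (k + 2) * 2) by lia.
           now rewrite Z_mod_plus_full. }
      apply same_vertex_row with (1 - q). unfold m in *; lia.
    + exists (t - 4 * k - 2). split; [lia|]. rewrite Z2Nat.id by lia.
      destruct (Z.leb_spec (t - 4 * k - 2) k); [lia|].
      destruct (Z.leb_spec (t - 4 * k - 2) (3 * k + 3)); [|lia].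
      replace ((t - 4 * k - 2) mod 2) with y.
      2: { replace (t - 4 * k - 2) with (t + (- 2 * k - 1) * 2) by lia.
           now rewrite Z_mod_plus_full. }
      destruct (Z.odd k).
      * apply same_vertex_up with (2 - q); unfold m in *; lia.
      * apply same_vertex_down with (2 - q); unfold m in *; lia.
    + exists t. split; [lia|]. rewrite Z2Nat.id by lia.
      destruct (Z.leb_spec t k); [lia|].
      destruct (Z.leb_spec t (3 * k + 3)); [lia|].
      destruct (Z.leb_spec t (7 * k + 5)); [lia|]. rewrite Ht.
      apply same_vertex_up with (4 - q); unfold m in *; lia.
Qed.

(** * Stacking and the case distinction on [n] *)

Lemma mobius_tour_stack (m h : Z) (q : nat) : 0 < m -> 0 < h ->
  (exists u, block m h (m - 1) u) ->
  exists w N, mobius_tour m (Z.of_nat q * 4 + h) w N.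
Proof.
  intros Hm Hh [u Hu]. destruct (block_return m Hm) as [v Hv].
  destruct (block_iter m 4 v ltac:(lia) Hv q) as [v' Hv'].
  apply mobius_tour_of_block with (v' ++ u); try lia.
  apply block_app; auto. lia.
Qed.

Theorem theorem6p3 (m n : Z) :
  0 < m -> 0 < n -> (1 < m \/ 1 < n) ->
  ((exists (w : nat -> pt) (N : nat), mobius_tour m n w N) <->
   (Z.odd m = true \/ Z.odd n = true)).
Proof.
  intros Hm Hn Hmn. split.
  - intros (w & N & H). exact (mobius_tour_odd m n Hm Hn w N H).
  - intros Hodd.
    destruct (Z.eq_dec n 1) as [->|H1]; [apply mobius_tour_one; lia|].
    destruct (Z.eq_dec n 2) as [->|H2].
    { assert (Hmo : Z.odd m = true) by (destruct Hodd; auto; discriminate).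
      apply Z.odd_spec in Hmo as [j ->].
      destruct (Z.Even_or_Odd j) as [[k ->]|[k ->]].
      - replace (2 * (2 * k) + 1) with (4 * k + 1) by lia. apply mobius_tour_two_1mod4. lia.
      - replace (2 * (2 * k + 1) + 1) with (4 * k + 3) by lia. apply mobius_tour_two_3mod4. lia. }
    (* As [n >= 3], division of [n - 3] by 4 gives [q >= 0] returning blocks below a shifting block
       of 3 to 6 rows. *)
    pose proof (Z.mod_pos_bound (n - 3) 4 eq_refl) as Hr.
    pose proof (Z.div_mod (n - 3) 4 ltac:(lia)) as Hd.
    set (q := (n - 3) / 4) in *.
    assert (Hcase : (n - 3) mod 4 = 0 \/ (n - 3) mod 4 = 1 \/
                    (n - 3) mod 4 = 2 \/ (n - 3) mod 4 = 3) by lia.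
    destruct Hcase as [H|[H|[H|H]]]; rewrite H in Hd.
    + replace n with (Z.of_nat (Z.to_nat q) * 4 + 3) by lia.
      apply mobius_tour_stack; try lia. now apply block_three.
    + replace n with (Z.of_nat (Z.to_nat q) * 4 + 4) by lia.
      apply mobius_tour_stack; try lia. apply block_four; auto.
      destruct Hodd as [Ho|[j Ho]%Z.odd_spec]; [exact Ho | lia].
    + replace n with (Z.of_nat (Z.to_nat q) * 4 + 5) by lia.
      apply mobius_tour_stack; try lia. now apply block_five.
    + replace n with (Z.of_nat (Z.to_nat q) * 4 + 6) by lia.
      apply mobius_tour_stack; try lia. apply block_six; auto.
      destruct Hodd as [Ho|[j Ho]%Z.odd_spec]; [exact Ho | lia].
Qed.
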